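(* Let $n,b,\bar m\ge 1$ be integers, $\mathbf{y}\in\mathbb{R}^n$, $\mathbf{\Phi}=(\phi_{ij})\in\mathbb{R}^{n\times b}$. Consider the discretely relaxed generalized linear regression model $\mathbf{y}=\mathbf{\Phi}\mathbf{w}+\boldsymbol{\epsilon}$, $\boldsymbol{\epsilon}\sim\mathcal{N}(\mathbf{0},\sigma^2\mathbf{I})$, in which the $j$-th latent variable $w_j$ takes values in the entries of $\bar{\mathbf{w}}_j\in\mathbb{R}^{\bar m}$ ($j=1,\dots,b$), the noise variance $\sigma^2$ takes values in the entries of a vector $\boldsymbol{\sigma}^2\in\mathbb{R}^{\bar m}$ with positive entries, and both the prior and the variational distribution over $(\sigma^2,w_1,\dots,w_b)$ factorize, with prior probability vectors $\mathbf{p}_\sigma,\mathbf{p}_1,\dots,\mathbf{p}_b\in(0,1)^{\bar m}$ and variational probability vectors $\mathbf{q}_\sigma,\mathbf{q}_1,\dots,\mathbf{q}_b\in(0,1)^{\bar m}$ (each with entries summing to $1$). Then $$ \begin{aligned} \mathsf{ELBO}={}&-\frac{n}{2}\,\mathbf{q}_\sigma^T\log\boldsymbol{\sigma}^2-\frac12\big(\mathbf{q}_\sigma^T\boldsymbol{\sigma}^{-2}\big)\Big(\mathbf{y}^T\mathbf{y}-2\,\mathbf{s}^T(\mathbf{\Phi}^T\mathbf{y})+\mathbf{s}^T\mathbf{\Phi}^T\mathbf{\Phi}\mathbf{s}-\mathrm{diag}(\mathbf{\Phi}^T\mathbf{\Phi})^T\mathbf{s}^2+\sum_{j=1}^b\mathbf{q}_j^T\mathbf{h}_j\Big)\\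 &+\sum_{i=1}^b\big(\mathbf{q}_i^T\log\mathbf{p}_i-\mathbf{q}_i^T\log\mathbf{q}_i\big)+\mathbf{q}_\sigma^T\log\mathbf{p}_\sigma-\mathbf{q}_\sigma^T\log\mathbf{q}_\sigma, \end{aligned} $$ where $\mathbf{s}=(\mathbf{q}_j^T\bar{\mathbf{w}}_j)_{j=1}^b\in\mathbb{R}^b$ and $\mathbf{h}_j=\bar{\mathbf{w}}_j^2\sum_{i=1}^n\phi_{ij}^2\in\mathbb{R}^{\bar m}$ for $j=1,\dots,b$.
   Context: Logarithms, squares, and inverse powers of vectors are taken elementwise ($\boldsymbol{\sigma}^{-2}$ is the vector of reciprocals of the entries of $\boldsymbol{\sigma}^2$; $\bar{\mathbf{w}}_j^2$ and $\mathbf{s}^2$ are elementwise squares). For a square matrix $A$, $\mathrm{diag}(A)$ is the vector of its diagonal entries. Write $\bar w_{jk}$ for the $k$-th entry of $\bar{\mathbf{w}}_j$, $\sigma^2_k$ for the $k$-th entry of $\boldsymbol{\sigma}^2$, and similarly $q_{jk},p_{jk},q_{\sigma,k},p_{\sigma,k}$. The evidence lower bound is the sum over the whole (finite) support grid: with indices $k_0,k_1,\dots,k_b\in\{1,\dots,\bar m\}$, $\mathbf{w}_{k}=(\bar w_{1k_1},\dots,\bar w_{bk_b})^T$, joint variational probability $q(k_0,\dots,k_b)=q_{\sigma,k_0}\prod_{j=1}^b q_{jk_j}$ and joint prior probability $p(k_0,\dots,k_b)=p_{\sigma,k_0}\prod_{j=1}^b p_{jk_j}$, $$\mathsf{ELBO}=\sum_{k_0,k_1,\dots,k_b}q(k_0,\dots,k_b)\Big(\log\ell(\mathbf{w}_k,\sigma^2_{k_0})+\log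 p(k_0,\dots,k_b)-\log q(k_0,\dots,k_b)\Big),$$ where $\log\ell$ is the Gaussian log-likelihood with the parameter-independent additive constant $-\frac n2\log(2\pi)$ dropped: $$\log\ell(\mathbf{w},\sigma^2)=-\frac n2\log\sigma^2-\frac1{2\sigma^2}(\mathbf{y}-\mathbf{\Phi}\mathbf{w})^T(\mathbf{y}-\mathbf{\Phi}\mathbf{w}).$$ *)

(* Defs.v *)
From mathcomp Require Import all_boot all_order all_algebra.
From mathcomp Require Import reals exp.

Set Implicit Arguments.
Unset Strict Implicit.
Unset Printing Implicit Defensive.

Import Order.TTheory GRing.Theory Num.Theory.
Local Open Scope ring_scope.

Definition dot (R : realType) (d : nat) (u v : 'cV[R]_d) : R :=
  (u^T *m v) 0 0.

Definition log_vec (R : realType) (d : nat) (v : 'cV[R]_d) : 'cV[R]_d :=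
  map_mx (@ln R) v.

Definition sqr_vec (R : realType) (d : nat) (v : 'cV[R]_d) : 'cV[R]_d :=
  map_mx (fun x : R => x ^+ 2) v.

Definition inv_vec (R : realType) (d : nat) (v : 'cV[R]_d) : 'cV[R]_d :=
  map_mx (fun x : R => x^-1) v.

(* As opposed to [diag_mx], which builds a diagonal matrix from a row vector. *)
Definition diag_vec (R : realType) (d : nat) (A : 'M[R]_d) : 'cV[R]_d :=
  \col_i A i i.

Definition open_prob_vec (R : realType) (d : nat) (p : 'cV[R]_d) : Prop :=
  (forall k : 'I_d, 0 < p k 0 < 1) /\ \sum_(k < d) p k 0 = 1.

(* Gaussian log-likelihood of y ~ N(Phi w, sigma2 I), up to the additive
   constant - n / 2 * log (2 pi). *)
Definition loglik (R : realType) (n b : nat)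
    (y : 'cV[R]_n) (Phi : 'M[R]_(n, b)) (w : 'cV[R]_b) (sigma2 : R) : R :=
  - (n%:R / 2) * ln sigma2
  - 1 / (2 * sigma2) * dot (y - Phi *m w) (y - Phi *m w).

(* A point of the support grid is a pair (k0, k): k0 selects the noise variance
   and k j selects the value of the j-th latent variable. *)
Definition grid_point (R : realType) (b m : nat)
    (wbar : 'I_b -> 'cV[R]_m) (k : {ffun 'I_b -> 'I_m}) : 'cV[R]_b :=
  \col_j wbar j (k j) 0.

Definition joint_prob (R : realType) (b m : nat)
    (psigma : 'cV[R]_m) (p : 'I_b -> 'cV[R]_m)
    (k0 : 'I_m) (k : {ffun 'I_b -> 'I_m}) : R :=
  psigma k0 0 * \prod_(j < b) p j (k j) 0.

Definition ELBO (R : realType) (n b m : nat)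
    (y : 'cV[R]_n) (Phi : 'M[R]_(n, b))
    (wbar : 'I_b -> 'cV[R]_m) (sigma2 : 'cV[R]_m)
    (psigma : 'cV[R]_m) (p : 'I_b -> 'cV[R]_m)
    (qsigma : 'cV[R]_m) (q : 'I_b -> 'cV[R]_m) : R :=
  \sum_(k0 < m) \sum_(k : {ffun 'I_b -> 'I_m})
    joint_prob qsigma q k0 k *
      (loglik y Phi (grid_point wbar k) (sigma2 k0 0)
       + ln (joint_prob psigma p k0 k)
       - ln (joint_prob qsigma q k0 k)).

Definition mean_vec (R : realType) (b m : nat)
    (q wbar : 'I_b -> 'cV[R]_m) : 'cV[R]_b :=
  \col_j dot (q j) (wbar j).

Definition h_vec (R : realType) (n b m : nat)
    (Phi : 'M[R]_(n, b)) (wbar : 'I_b -> 'cV[R]_m) (j : 'I_b) : 'cV[R]_m :=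
  (\sum_(i < n) Phi i j ^+ 2) *: sqr_vec (wbar j).

(* Main.v *)
(* The joint weight of a grid point is a product, so averages over the grid are
   expectations under a product measure: a function of one coordinate averages
   against its own factor, and two distinct coordinates are uncorrelated.  The
   logarithms of the joint probabilities split into sums over coordinates, and
   the residual sum of squares is a quadratic form in w, whose expectation is
   its value at the mean s plus the diagonal correction
   \sum_j (Phi^T Phi)_jj (E w_j^2 - s_j^2). *)
Require Import Defs.
From mathcomp Require Import all_boot all_order all_algebra.
From mathcomp Require Import reals exp.
From mathcomp Require Import ring.
Import Order.TTheory GRing.Theory Num.Theory.
Local Open Scope ring_scope.

(** Expectation under the product of the weights [q j]. Grid points are finite functions so that
    sums over them expand by distributivity. *)
Definition expect {R : comNzRingType} {I T : finType} (q : I -> T -> R)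
    (f : {ffun I -> T} -> R) : R :=
  \sum_(k : {ffun I -> T}) (\prod_j q j (k j)) * f k.

Lemma expectD {R : comNzRingType} {I T : finType} (q : I -> T -> R) f g :
  expect q (fun k => f k + g k) = expect q f + expect q g.
Proof. by rewrite -big_split /=; apply: eq_bigr => k _; rewrite mulrDr. Qed.

Lemma expectZ {R : comNzRingType} {I T : finType} (q : I -> T -> R) c f :
  expect q (fun k => c * f k) = c * expect q f.
Proof. by rewrite mulr_sumr; apply: eq_bigr => k _; rewrite mulrCA. Qed.

Lemma expectB {R : comNzRingType} {I T : finType} (q : I -> T -> R) f g :
  expect q (fun k => f k - g k) = expect q f - expect q g.
Proof. by rewrite -sumrB; apply: eq_bigr => k _; rewrite mulrBr. Qed.

Lemma expect_sum {R : comNzRingType} {I T J : finType} (q : I -> T -> R)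
    (f : J -> {ffun I -> T} -> R) :
  expect q (fun k => \sum_j f j k) = \sum_j expect q (f j).
Proof.
by rewrite exchange_big /=; apply: eq_bigr => k _; rewrite mulr_sumr.
Qed.

Lemma eq_expect {R : comNzRingType} {I T : finType} (q : I -> T -> R) f g :
  f =1 g -> expect q f = expect q g.
Proof. by move=> fg; apply: eq_bigr => k _; rewrite fg. Qed.

(** Distributivity of products over sums, read backwards: the finite Fubini formula. The marginal
    formulas below come from it by taking factors equal to 1 at all coordinates of no interest. *)
Lemma expect_prod {R : comNzRingType} {I T : finType} (q g : I -> T -> R) :
  expect q (fun k => \prod_j g j (k j)) = \prod_j \sum_t q j t * g j t.
Proof.
rewrite bigA_distr_bigA /=; apply: eq_bigr => k _.
by rewrite -big_split.
Qed.

Section Marginals.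
Context {R : comNzRingType} {I T : finType} {q : I -> T -> R}.
Hypothesis q1 : forall j, \sum_t q j t = 1.

Lemma expect_cst c : expect q (fun=> c) = c.
Proof.
rewrite -[RHS]mulr1 -[c in LHS]mulr1 (expectZ q c (fun=> 1)); congr (_ * _).
transitivity (\prod_j \sum_t q j t * 1).
  by rewrite -(expect_prod q (fun _ _ => 1)); apply: eq_expect => k; rewrite big1.
rewrite big1 // => j _; rewrite -[RHS](q1 j).
by apply: eq_bigr => t _; rewrite mulr1.
Qed.

Lemma expect_coord i (f : T -> R) :
  expect q (fun k => f (k i)) = \sum_t q i t * f t.
Proof.
(* Every factor [j != i] becomes the total mass of [q j], which is 1. *)
pose g j t := if j == i then f t else 1.
transitivity (\prod_j \sum_t q j t * g j t).
  rewrite -expect_prod; apply: eq_expect => k.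
  by rewrite /g -big_mkcond big_pred1_eq.
rewrite /g (bigD1 i) //= eqxx [X in _ * X]big1 ?mulr1 // => j /negPf ->.
by rewrite -[RHS](q1 j); apply: eq_bigr => t _; rewrite mulr1.
Qed.

Lemma expect_coord2 i j (f g : T -> R) : i != j ->
  expect q (fun k => f (k i) * g (k j)) =
  (\sum_t q i t * f t) * (\sum_t q j t * g t).
Proof.
move=> ij; have ji : (j == i) = false by rewrite eq_sym (negPf ij).
pose h l t := if l == i then f t else if l == j then g t else 1.
transitivity (\prod_l \sum_t q l t * h l t).
  rewrite -expect_prod; apply: eq_expect => k.
  rewrite /h (bigD1 i) //= eqxx (bigD1 j) ?ji //= eqxx.
  by rewrite big1 ?mulr1 // => l /andP[/negPf -> /negPf ->].
rewrite /h (bigD1 i) //= eqxx (bigD1 j) ?ji //= eqxx.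
rewrite [X in _ * (_ * X)]big1 ?mulr1 // => l /andP[/negPf -> /negPf ->].
by rewrite -[RHS](q1 l); apply: eq_bigr => t _; rewrite mulr1.
Qed.

(** Independence turns each off-diagonal term into [G i j * (s i * s j)]. A diagonal term involves a
    second moment instead, and the bracket on the right exchanges [s i ^+ 2] for it. *)
Lemma expect_bilinear (G : I -> I -> R) (w : I -> T -> R) :
  let s i := \sum_t q i t * w i t in
  expect q (fun k => \sum_i \sum_j G i j * (w i (k i) * w j (k j))) =
  \sum_i \sum_j G i j * (s i * s j)
  + (\sum_i G i i * (\sum_t q i t * w i t ^+ 2) - \sum_i G i i * s i ^+ 2).
Proof.
move=> s; rewrite expect_sum -sumrB -big_split /=; apply: eq_bigr => i _.
rewrite expect_sum (bigD1 i) //= [in RHS](bigD1 i) //= -expr2.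
rewrite expectZ (expect_coord i (fun t => w i t ^+ 2)).
under eq_bigr => j ji do rewrite expectZ (@expect_coord2 i j) 1?eq_sym //.
ring.
Qed.

End Marginals.

Lemma dotE (R : realType) (d : nat) (u v : 'cV[R]_d) :
  dot u v = \sum_k u k 0 * v k 0.
Proof. by rewrite /dot mxE; apply: eq_bigr => k _; rewrite mxE. Qed.

Lemma dot_mulmx (R : realType) (d : nat) (A : 'M[R]_d) (u v : 'cV[R]_d) :
  dot u (A *m v) = \sum_i \sum_j A i j * (u i 0 * v j 0).
Proof.
rewrite dotE; apply: eq_bigr => i _; rewrite mxE mulr_sumr.
by apply: eq_bigr => j _; ring.
Qed.

Lemma dot_residual (R : realType) (n b : nat) (y : 'cV[R]_n)
    (Phi : 'M[R]_(n, b)) (w : 'cV[R]_b) :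
  dot (y - Phi *m w) (y - Phi *m w) =
  dot y y - 2 * dot w (Phi^T *m y) + dot w (Phi^T *m Phi *m w).
Proof.
(* The cross terms are transposes of each other, and a 1 x 1 matrix is scalar, hence its own
   transpose; this gives the factor 2. *)
have sym : y^T *m (Phi *m w) = w^T *m (Phi^T *m y).
  by rewrite -[LHS]trmxK [in RHS]mulmxA -trmx_mul [X in _ = X]mx11_scalar
     [X in X^T]mx11_scalar tr_scalar_mx; congr _%:M; rewrite !trmx_mul trmxK.
rewrite /dot [(_ - _)^T]linearB /= mulmxBl !mulmxBr sym trmx_mul -!mulmxA !mxE.
ring.
Qed.

Lemma ln_prod (R : realType) (I : finType) (x : I -> R) :
  (forall i, 0 < x i) -> ln (\prod_i x i) = \sum_i ln (x i).
Proof.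
(* Positivity of the partial product joins the induction because [lnM] requires both factors
   positive. *)
move=> x0; suff [] : 0 < \prod_i x i /\ ln (\prod_i x i) = \sum_i ln (x i) by [].
elim/big_rec2: _ => [|i s t _ [t0 ts]]; first by rewrite ltr01 ln1.
by rewrite mulr_gt0 // lnM ?posrE // ts.
Qed.

Lemma ln_joint_prob (R : realType) (b m : nat) (psigma : 'cV[R]_m)
    (p : 'I_b -> 'cV[R]_m) k0 k :
  open_prob_vec psigma -> (forall j, open_prob_vec (p j)) ->
  ln (joint_prob psigma p k0 k) = ln (psigma k0 0) + \sum_j ln (p j (k j) 0).
Proof.
move=> [ps _] hp.
have p0 j : 0 < p j (k j) 0 by have [/(_ (k j))/andP[]] := hp j.
have /andP[ps0 _] := ps k0.
by rewrite lnM ?posrE ?prodr_gt0 // ln_prod.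
Qed.

Section ProductModel.
Context {R : realType} {b m : nat} {q : 'I_b -> 'cV[R]_m}.
Hypothesis q1 : forall j, \sum_k q j k 0 = 1.
Let qf j t := q j t 0.

Lemma expect_residual n (y : 'cV[R]_n) (Phi : 'M[R]_(n, b))
    (wbar : 'I_b -> 'cV[R]_m) :
  let s := mean_vec q wbar in
  expect qf (fun k => dot (y - Phi *m grid_point wbar k)
                          (y - Phi *m grid_point wbar k)) =
  dot y y - 2 * dot s (Phi^T *m y) + dot s (Phi^T *m Phi *m s)
  - dot (diag_vec (Phi^T *m Phi)) (sqr_vec s)
  + \sum_(j < b) dot (q j) (h_vec Phi wbar j).
Proof.
move=> s.
have sE i : s i 0 = \sum_t qf i t * wbar i t 0 by rewrite mxE dotE.
under eq_expect => k do rewrite dot_residual.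
rewrite expectD expectB expectZ (expect_cst q1).
have -> : expect qf (fun k => dot (grid_point wbar k) (Phi^T *m y)) =
    dot s (Phi^T *m y).
  under eq_expect => k.
    rewrite dotE; under eq_bigr => j _ do rewrite mxE mulrC; over.
  rewrite expect_sum dotE; apply: eq_bigr => j _.
  by rewrite expectZ (expect_coord q1 j (fun t => wbar j t 0)) -sE mulrC.
set G := Phi^T *m Phi.
have -> : expect qf (fun k => dot (grid_point wbar k)
    (G *m grid_point wbar k)) = dot s (G *m s)
  + (\sum_j dot (q j) (h_vec Phi wbar j) - dot (diag_vec G) (sqr_vec s)).
  under eq_expect => k.
    rewrite dot_mulmx; under eq_bigr => i _ do
      under eq_bigr => j _ do rewrite ![grid_point _ _ _ _]mxE; over.
  rewrite (expect_bilinear q1 (fun i j => G i j) (fun j t => wbar j t 0)).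
  congr (_ + (_ - _)).
  - rewrite dot_mulmx; apply: eq_bigr => i _; apply: eq_bigr => j _.
    by rewrite !sE.
  (* The diagonal entry [G j j] is the squared norm of column [j] of [Phi], which is the scalar in
     [h_vec]. *)
  - apply: eq_bigr => j _; rewrite dotE mulr_sumr; apply: eq_bigr => t _.
    rewrite !mxE mulrCA; congr (_ * (_ * _)).
    by apply: eq_bigr => i _; rewrite mxE expr2.
  - by rewrite dotE; apply: eq_bigr => j _; rewrite !mxE -sE !mxE.
ring.
Qed.

Lemma expect_sum_ln (p : 'I_b -> 'cV[R]_m) :
  expect qf (fun k => \sum_j ln (p j (k j) 0)) =
  \sum_j dot (q j) (log_vec (p j)).
Proof.
rewrite expect_sum; apply: eq_bigr => j _.
rewrite (expect_coord q1 j (fun t => ln (p j t 0))) dotE.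
by apply: eq_bigr => t _; rewrite mxE.
Qed.

End ProductModel.

Theorem theorem1 (R : realType) (n b m : nat)
    (hn : (1 <= n)%N) (hb : (1 <= b)%N) (hm : (1 <= m)%N)
    (y : 'cV[R]_n) (Phi : 'M[R]_(n, b))
    (wbar : 'I_b -> 'cV[R]_m) (sigma2 : 'cV[R]_m)
    (hsigma2 : forall k : 'I_m, 0 < sigma2 k 0)
    (psigma : 'cV[R]_m) (p : 'I_b -> 'cV[R]_m)
    (qsigma : 'cV[R]_m) (q : 'I_b -> 'cV[R]_m)
    (hpsigma : open_prob_vec psigma)
    (hp : forall j : 'I_b, open_prob_vec (p j))
    (hqsigma : open_prob_vec qsigma)
    (hq : forall j : 'I_b, open_prob_vec (q j)) :
  let s := mean_vec q wbar in
  let h := h_vec Phi wbar in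
  ELBO y Phi wbar sigma2 psigma p qsigma q =
    - (n%:R / 2) * dot qsigma (log_vec sigma2)
    - 1 / 2 * dot qsigma (inv_vec sigma2) *
        (dot y y
         - 2 * dot s (Phi^T *m y)
         + dot s (Phi^T *m Phi *m s)
         - dot (diag_vec (Phi^T *m Phi)) (sqr_vec s)
         + \sum_(j < b) dot (q j) (h j))
    + \sum_(i < b) (dot (q i) (log_vec (p i)) - dot (q i) (log_vec (q i)))
    + dot qsigma (log_vec psigma) - dot qsigma (log_vec qsigma).
Proof.
move=> s h; have q1 j : \sum_t q j t 0 = 1 by case: (hq j).
pose qf j t := q j t 0.
pose RSS := expect qf (fun k => dot (y - Phi *m grid_point wbar k)
                                    (y - Phi *m grid_point wbar k)).
pose P := \sum_j dot (q j) (log_vec (p j)).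
pose Q := \sum_j dot (q j) (log_vec (q j)).
(* With the noise index fixed, only the average over the weights remains. Each term on the right is
   a factor independent of [k0] times [qsigma k0 0], possibly times a vector entry, so that summing
   over [k0] produces [dot] products. *)
have inner k0 : \sum_(k : {ffun 'I_b -> 'I_m}) joint_prob qsigma q k0 k *
      (loglik y Phi (grid_point wbar k) (sigma2 k0 0)
       + ln (joint_prob psigma p k0 k) - ln (joint_prob qsigma q k0 k)) =
    - (n%:R / 2) * (qsigma k0 0 * log_vec sigma2 k0 0)
    - 1 / 2 * RSS * (qsigma k0 0 * inv_vec sigma2 k0 0)
    + (P - Q) * qsigma k0 0
    + qsigma k0 0 * log_vec psigma k0 0 - qsigma k0 0 * log_vec qsigma k0 0.
  transitivity (qsigma k0 0 * expect qf (fun k =>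
    loglik y Phi (grid_point wbar k) (sigma2 k0 0)
    + (ln (psigma k0 0) + \sum_j ln (p j (k j) 0))
    - (ln (qsigma k0 0) + \sum_j ln (q j (k j) 0)))).
    (* The entries of all probability vectors are positive, so both joint logarithms split. *)
    rewrite mulr_sumr; apply: eq_bigr => k _.
    by rewrite !ln_joint_prob // /joint_prob -mulrA.
  rewrite /loglik expectB expectD expectB !expectD.
  rewrite (expectZ _ (1 / (2 * sigma2 k0 0))) !(expect_cst q1).
  rewrite !(expect_sum_ln q1) -/RSS -/P -/Q !mxE invfM; ring.
rewrite /ELBO; under eq_bigr => k0 _ do rewrite inner.
rewrite !big_split /= !sumrN -!mulr_sumr -!dotE.
(* The term [P - Q] does not depend on the noise index and is multiplied by the total mass of
   [qsigma], which is 1. *)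
have [_ ->] := hqsigma.
rewrite /RSS expect_residual // -/P -/Q; ring.
Qed.
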